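(* Consider an OPM search tree for pieces $\mathcal J$ and bins $\mathcal I$ constructed under one specified order, either pickup-sorted or delivery-sorted. If the partial OPM $f_\rho$ at a node violates the monotonicity requirement induced by the other order (i.e., there are two assigned pieces $s,t$ such that $s$ precedes $t$ among the pieces in the other order but $f_\rho(s)$ comes strictly after $f_\rho(t)$ among the bins in the other order), then no extension of this partial OPM satisfies the monotonicity requirements of both orders; hence the corresponding branch can be pruned (pruning it discards no complete mapping that is monotone under both orders).
   Context: $\mathcal J$ (pieces) and $\mathcal I$ (bins) are finite sets of items. Each set carries two linear orders: the pickup-sorted order (reverse order of pickup) and the delivery-sorted order (order of delivery). Fix one of the two orders and write $\mathcal{J}=(j_1,\dots,j_{|\mathcal{J}|})$ and $\mathcal{I}=(i_1,\dots,i_{|\mathcal{I}|})$ for the sequences in that order; bins are compared by their position in the sequence. An order-preserving mapping (OPM) under an order is a function $f:\mathcal J\to\mathcal I$ that is monotone (non-decreasing) with respect to that order on pieces and bins. A partial OPM is a function $f:\mathcal J'\to\mathcal I$ on a subset $\mathcal J'\subseteq\mathcal J$ such that $f(j)\le f(j')$ whenever $j<j'$ in $\mathcal J'$. The OPM search tree under the fixed order is the rooted tree of depth $|\mathcal J|$ whose nodes at depth $\rho$ are the partial OPMs $f_\rho:\{j_1,\dots,j_\rho\}\to\mathcal I$; the root is the empty mapping; at depth $1$ the piece $j_1$ is assigned to any bin; a node at depth $\rho\ge2$ is obtained from a node $f_{\rho-1}$ by assigning $j_\rho$ to a bin with $f_\rho(j_\rho)\ge f_{\rho-1}(j_{\rho-1})$.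 An extension of $f_\rho$ is a mapping on a larger set of pieces agreeing with $f_\rho$ on $\{j_1,\dots,j_\rho\}$; the branch at a node consists of the node and all its descendants. *)

(* Defs.v *)
From mathcomp Require Import all_boot.

Set Implicit Arguments.
Unset Strict Implicit.
Unset Printing Implicit Defensive.

(* [Pickup] is the pickup-sorted order, i.e. the reverse order of pickup;
   [Delivery] is the order of delivery. *)
Variant criterion := Pickup | Delivery.

Definition other (c : criterion) : criterion :=
  match c with Pickup => Delivery | Delivery => Pickup end.

Definition linear_order (T : Type) (le : rel T) : Prop :=
  [/\ reflexive le, antisymmetric le, transitive le & total le].

Definition strict (T : eqType) (le : rel T) : rel T :=
  fun x y => le x y && (x != y).

Section SearchTree.

Variables J I : finType.

(* [f j = None] means that the piece [j] is not in the domain of [f]. *)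
Definition partial_map : Type := {ffun J -> option I}.

Definition empty_map : partial_map := [ffun => None].

Definition assign (f : partial_map) (j : J) (i : I) : partial_map :=
  [ffun x => if x == j then Some i else f x].

Definition complete (f : partial_map) : Prop := forall j, exists i, f j = Some i.

Definition extends (f g : partial_map) : Prop :=
  forall j i, f j = Some i -> g j = Some i.

Variables (leJ : rel J) (leI : rel I).

Definition partial_opm (f : partial_map) : Prop :=
  forall j j' i i', f j = Some i -> f j' = Some i' ->
    strict leJ j j' -> leI i i'.

Definition violates (f : partial_map) : Prop :=
  exists s t i i', [/\ f s = Some i, f t = Some i',
    strict leJ s t & strict leI i' i].

(* The sequence of pieces is numbered from 0, so that the children of a node
   at depth [rho] assign [onth pieces rho]. *)
Definition pieces : seq J := sort leJ (enum J).

Inductive opm_child : nat -> partial_map -> partial_map -> Prop :=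
| opm_child_first (f : partial_map) j i :
    onth pieces 0 = Some j ->
    opm_child 0 f (assign f j i)
| opm_child_next rho (f : partial_map) j j' i i' :
    onth pieces rho = Some j -> onth pieces rho.+1 = Some j' ->
    f j = Some i -> leI i i' ->
    opm_child rho.+1 f (assign f j' i').

(* [opm_branch rho f sigma g]: the node [g] at depth [sigma] is the node [f]
   at depth [rho] or one of its descendants. *)
Inductive opm_branch (rho : nat) (f : partial_map) : nat -> partial_map -> Prop :=
| opm_branch_self : opm_branch rho f rho f
| opm_branch_child sigma g h :
    opm_branch rho f sigma g -> opm_child sigma g h ->
    opm_branch rho f sigma.+1 h.

Definition opm_tree : nat -> partial_map -> Prop := opm_branch 0 empty_map.

Definition opm_pruned_tree (rho : nat) (f : partial_map)
    (sigma : nat) (g : partial_map) : Prop :=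
  opm_tree sigma g /\ ~ opm_branch rho f sigma g.

End SearchTree.

(* Main.v *)
Require Import Defs.
From mathcomp Require Import all_boot.

Set Implicit Arguments.
Unset Strict Implicit.
Unset Printing Implicit Defensive.

(** A violation of the other order consists of two assigned pieces and their
    bins. An extension keeps both assignments, so it contains the same two
    pieces in the wrong order, and by antisymmetry of the order on bins it is
    not monotone (lemma [violates_extends]).

    For the pruning claim it remains to see that every node of the branch is an
    extension ([opm_branch_extends]). This is where the shape of the tree
    matters: a step down assigns one piece and would overwrite an earlier
    value of that piece. It never does, because the pieces already assigned at
    a node of depth [rho] have positions below [rho] in the sorted sequence
    ([opm_tree_domain]), while the steps below that node assign the pieces at
    positions [rho] and later; the sequence has no duplicates, so these pieces
    are new. Hence a mapping that is monotone under both orders cannot lie in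
    the branch. *)

Section SearchTree.

Variables (J I : finType) (leJ : rel J) (leI : rel I).
Implicit Types f g h : partial_map J I.

Lemma violates_extends f g :
  antisymmetric leI -> violates leJ leI f -> extends f g ->
  ~ partial_opm leJ leI g.
Proof.
move=> leI_anti [s [t [i [i' [fs ft lt_st /andP[le_i'i neq_i'i]]]]]] fg g_opm.
have le_ii' := g_opm _ _ _ _ (fg _ _ fs) (fg _ _ ft) lt_st.
by case/eqP: neq_i'i; apply: leI_anti; rewrite le_i'i.
Qed.

Lemma opm_child_assign sigma g h :
  opm_child leJ leI sigma g h ->
  exists j i, index j (pieces leJ) = sigma /\ h = assign g j i.
Proof.
have index_onth k j : onth (pieces leJ) k = Some j -> index j (pieces leJ) = k.
  move=> k_j; rewrite -(onth_nth j _ _ _ k_j) index_uniq ?sort_uniq ?enum_uniq //.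
  by rewrite -onthTE k_j.
by case=> [{}g j i /index_onth|{}sigma {}g j0 j i0 i _ /index_onth]; exists j, i.
Qed.

(** This bound is what keeps the descendants of a node from reassigning a
    piece that the node has already placed. *)
Lemma opm_tree_domain rho f j i :
  opm_tree leJ leI rho f -> f j = Some i -> index j (pieces leJ) < rho.
Proof.
move=> f_node; elim: f_node j i => [|sigma g h _ IH gh] j i; first by rewrite ffunE.
have [j1 [i1 [j1_pos ->]]] := opm_child_assign gh.
rewrite ffunE; case: eqP => [->|_ /IH]; last exact: leqW.
by rewrite j1_pos.
Qed.

(** The depth bound is proved together with the extension property, since it is
    what shows that the piece assigned at each step is new to [f]. *)
Lemma opm_branch_extends rho f sigma g :
  opm_tree leJ leI rho f -> opm_branch leJ leI rho f sigma g ->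
  rho <= sigma /\ extends f g.
Proof.
move=> f_node; elim=> [|{}sigma {}g h _ [le_rho fg] gh]; first by split.
split=> [|j i fj]; first exact: leqW.
have [j1 [i1 [j1_pos ->]]] := opm_child_assign gh.
rewrite ffunE; case: eqP => [eq_j|_]; last exact: fg.
have := opm_tree_domain f_node fj.
by rewrite eq_j j1_pos ltnNge le_rho.
Qed.

End SearchTree.

Theorem proposition4 (J I : finType)
    (leJ : criterion -> rel J) (leI : criterion -> rel I)
    (leJ_linear : forall c, linear_order (leJ c))
    (leI_linear : forall c, linear_order (leI c))
    (c : criterion) (rho : nat) (f : partial_map J I)
    (f_node : opm_tree (leJ c) (leI c) rho f)
    (f_violates : violates (leJ (other c)) (leI (other c)) f) :
  (forall g : partial_map J I, extends f g ->
     ~ (partial_opm (leJ Pickup) (leI Pickup) g /\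
        partial_opm (leJ Delivery) (leI Delivery) g)) /\
  (forall (sigma : nat) (g : partial_map J I),
     opm_tree (leJ c) (leI c) sigma g -> complete g ->
     partial_opm (leJ Pickup) (leI Pickup) g ->
     partial_opm (leJ Delivery) (leI Delivery) g ->
     opm_pruned_tree (leJ c) (leI c) rho f sigma g).
Proof.
have no_opm g : extends f g ->
    ~ (partial_opm (leJ Pickup) (leI Pickup) g /\
       partial_opm (leJ Delivery) (leI Delivery) g).
  move=> fg [gP gD]; have [_ leI_anti _ _] := leI_linear (other c).
  by apply: (violates_extends leI_anti f_violates fg); case: (c).
split=> // sigma g g_node _ gP gD; split=> // /(opm_branch_extends f_node)[_ fg].
exact: (no_opm g fg).
Qed.
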